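(* Let $1\le p\le\infty$, and let $X\subset\mathbb{R}^4$ be a bounded set containing at least two points. Then $$b_{C_{4,p}}(X)\le 2^4,$$ that is, $X$ can be represented as the union of at most $16$ subsets, each of which has $\ell_p$-diameter strictly smaller than the $\ell_p$-diameter of $X$.
   Context: For $\mathbf{x}=(x_1,\dots,x_n)\in\mathbb{R}^n$ and real $p\ge 1$, $\|\mathbf{x}\|_p=(|x_1|^p+\cdots+|x_n|^p)^{1/p}$, and $\|\mathbf{x}\|_\infty=\max_i|x_i|$. The four-dimensional $\ell_p$ space is $\mathbb{R}^4$ with the norm $\|\cdot\|_p$, whose unit ball is $C_{4,p}=\{\mathbf{x}\in\mathbb{R}^4:\|\mathbf{x}\|_p\le 1\}$. For a bounded set $X\subset\mathbb{R}^4$, its diameter is $d_{C_{4,p}}(X)=\sup\{\|\mathbf{x}-\mathbf{y}\|_p:\mathbf{x},\mathbf{y}\in X\}$, and $b_{C_{4,p}}(X)$ is the smallest number $b$ such that $X=X_1\cup\cdots\cup X_b$ for some subsets $X_i\subseteq X$ with $d_{C_{4,p}}(X_i)<d_{C_{4,p}}(X)$ for all $i$. *)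

(* Defs.v *)
From HB Require Import structures.
From mathcomp Require Import all_boot all_order all_algebra.
From mathcomp Require Import all_classical all_reals all_analysis.

Set Implicit Arguments.
Unset Strict Implicit.
Unset Printing Implicit Defensive.

Import Order.TTheory GRing.Theory Num.Theory.
Import numFieldNormedType.Exports.

Local Open Scope classical_set_scope.
Local Open Scope ring_scope.

(* The exponent ranges over [\bar R], with [+oo] giving the maximum norm; only
   the values for [1 <= p] are meaningful. *)
Definition lp_norm (R : realType) (n : nat) (p : \bar R) (x : 'rV[R]_n) : R :=
  match p with
  | r%:E => (\sum_(i < n) `|x ord0 i| `^ r) `^ r^-1
  | +oo%E => \big[Num.max/0]_(i < n) `|x ord0 i|
  | -oo%E => 0
  end.

(* [sup] is the real supremum: it is the least upper bound for bounded nonempty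
   [X], and the diameter of the empty set is [0]. *)
Definition lp_diam (R : realType) (n : nat) (p : \bar R) (X : set 'rV[R]_n) : R :=
  sup [set lp_norm p (x - y) | x in X & y in X].

Definition diam_reducible (R : realType) (n : nat) (p : \bar R)
    (X : set 'rV[R]_n) (b : nat) : Prop :=
  exists F : 'I_b -> set 'rV[R]_n,
    [/\ X = \bigcup_(i in [set: 'I_b]) F i,
        forall i, F i `<=` X
      & forall i, lp_diam p (F i) < lp_diam p X].

(* A relation rather than a function, so that no junk value is needed for sets
   that admit no finite decomposition. *)
Definition is_borsuk_number (R : realType) (n : nat) (p : \bar R)
    (X : set 'rV[R]_n) (b : nat) : Prop :=
  diam_reducible p X b /\ forall c : nat, diam_reducible p X c -> (b <= c)%N.

(* Main.v *)
Require Import Defs.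
From HB Require Import structures.
From mathcomp Require Import all_boot all_order all_algebra.
From mathcomp Require Import all_classical all_reals all_analysis.
From mathcomp Require Import ring lra.

Set Implicit Arguments.
Unset Strict Implicit.
Unset Printing Implicit Defensive.

Import Order.TTheory GRing.Theory Num.Theory.
Import numFieldNormedType.Exports.

Local Open Scope classical_set_scope.
Local Open Scope ring_scope.

(** Let [D > 0] be the diameter of [X].  It is enough to colour the points of
    [X] with 16 colours so that points of one colour are at distance at most
    some constant [c < D] ([diam_reducible_of_coloring]).  The colours are the
    sign patterns of four coordinates, that is, the orthants of a box
    around [X]; the coordinates and the correction near the walls depend on [p].

    For [p > 2], [X] lies in a cube of side [D], and cutting it in halves along
    every axis gives cubes of [lp]-diameter [4 ^ (1/p) * D / 2 < D]; for
    [p = +oo] they have diameter [D / 2].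

    For [p = 2] the half cubes have diameter exactly [D], attained only along
    their main diagonals.  Scale the cube to [[-1, 1]^4], and move the cut
    orthogonal to one axis a little to one side.  If this fails for all eight
    choices of an axis and a side, then [X] contains, for each of them, a
    nearly diagonal pair: in each coordinate one point is near [0] and the
    other near [1] or [-1].  Two points of [X] that nearly differ by the full
    side of the cube in one coordinate nearly agree in the others, because the
    Euclidean diameter is [D].  Playing these pairs against each other shows
    that no point of such a pair is near [1] or [-1] in two coordinates
    ([euclid_coloring]); this is absurd, since each of the four coordinates is
    near [1] or [-1] at one of the two points.

    For [1 <= p < 2] use the coordinates [H x], with [H] the 4 x 4 Hadamard
    matrix of Sylvester.  By the power mean inequality [X] lies in a box of
    side [L = 4 ^ (1 - 1/p) * D] in these coordinates.  Since [H / 2] is orthogonal, an orthant of that box has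
    Euclidean diameter [L / 2], hence [lp]-diameter at most [D].
    Again only main diagonals matter.  The columns of [H] are even sign
    vectors, that is, they have an even number of minus signs, and every even
    sign vector is a column or its negative; so the two ends of an even diagonal
    differ by a multiple of a unit vector, with [lp]-norm well below [D].  The
    odd diagonals are destroyed by recolouring: a point near the grid
    [{-1, 0, 1}^4] with some coordinate near [0] may move to the neighbouring
    orthant across that wall, and the parity of its signs can be chosen so that
    no two points of one colour are near the ends of an odd diagonal
    ([recolor_dichotomy]). *)

(** * Cutting the cube for the Euclidean norm *)

Section EuclideanCut.
Context {R : realFieldType}.

(** Distances within a piece are bounded away from its diagonal by exhibiting
    one short coordinate. *)
Lemma sum4_le_isolate (f : 'I_4 -> R) (B : R) (j : 'I_4) :
  (forall k, f k <= B) -> \sum_k f k <= f j + 3 * B.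
Proof.
move=> fB; rewrite (bigD1 j) //= lerD2l.
have /le_trans-> // : \sum_(k < 4 | k != j) f k <= \sum_(k < 4 | k != j) B.
  by apply: ler_sum.
by rewrite sumr_const cardC1 card_ord mulr_natl.
Qed.

Lemma sqr_le_of_norm (a b : R) : `|a| <= b -> a ^+ 2 <= b ^+ 2.
Proof.
move=> ab; rewrite -real_normK ?num_real// lerXn2r ?nnegrE//.
exact: le_trans ab.
Qed.

(** Together with a common colour this makes [u] and [v], up to [e], opposite
    vertices of one of the unit cubes into which the coordinate hyperplanes cut
    [[-1, 1]^n]. *)
Definition corner_pair (e : R) n (u v : 'I_n -> R) : Prop := forall j,
  (1 - e <= `|u j| /\ `|v j| <= e) \/ (`|u j| <= e /\ 1 - e <= `|v j|).

Lemma corner_pair_sym e n (u v : 'I_n -> R) :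
  corner_pair e u v -> corner_pair e v u.
Proof. by move=> uv j; case: (uv j); tauto. Qed.

Lemma same_side_dist (a b : R) : `|a| <= 1 -> `|b| <= 1 ->
  (0 <= a) = (0 <= b) -> `|a - b| <= 1.
Proof.
rewrite !ler_norml => /andP[? ?] /andP[? ?].
by case: (lerP 0 a); case: (lerP 0 b) => // *; lra.
Qed.

(** The signs [(-1) ^+ b * y j] are used in all coordinates, not only in the
    shifted one, so that [b = true] is the mirror image of [b = false]. *)
Definition shifted_cut (d : R) (i : 'I_4) (b : bool) (y : 'I_4 -> R) :
    {ffun 'I_4 -> bool} :=
  [ffun j => (if j == i then d else 0) <= (-1) ^+ b * y j].

Local Notation shift := (400^-1 : R).
Local Notation tol := (40^-1 : R).
Local Notation short := (3 + (1 - shift) ^+ 2 : R).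

(** The piece on the narrow side of the shifted wall is short, so a pair at
    distance close to [2] lies on the wide side.  It can gain only about [shift]
    there, so every coordinate difference must be close to [1]; in the shifted
    coordinate this forces one point to the far wall. *)
Lemma shifted_cut_far (i : 'I_4) (b : bool) (y y' : 'I_4 -> R) :
  (forall j, `|y j| <= 1) -> (forall j, `|y' j| <= 1) ->
  shifted_cut shift i b y = shifted_cut shift i b y' ->
  short < \sum_j (y j - y' j) ^+ 2 ->
  corner_pair tol y y' /\
  ((-1) ^+ b * y i <= - (1 - tol) \/ (-1) ^+ b * y' i <= - (1 - tol)).
Proof.
move=> y1 y1' eqc far.
have eqj j : ((if j == i then shift else 0) <= (-1) ^+ b * y j) =
             ((if j == i then shift else 0) <= (-1) ^+ b * y' j).
  by move/ffunP: eqc => /(_ j); rewrite !ffunE.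
have bnd w : `|w| <= 1 -> -1 <= (-1) ^+ b * w <= (1 : R).
  by case: b {eqc eqj}; rewrite ?expr1 ?expr0 ler_norml => /andP[]; lra.
have normE w : `|w| = `|(-1) ^+ b * w| by rewrite normrMsign.
have sqE j : (y j - y' j) ^+ 2 =
             ((-1) ^+ b * y j - (-1) ^+ b * y' j) ^+ 2.
  by rewrite -mulrBr exprMn sqrr_sign mul1r.
have dj j : j != i -> `|(-1) ^+ b * y j - (-1) ^+ b * y' j| <= 1.
  move=> ji; apply: same_side_dist; rewrite ?normrMsign//.
  by have := eqj j; rewrite (negbTE ji).
have [wi wi'] : (-1) ^+ b * y i < shift /\ (-1) ^+ b * y' i < shift.
  have := eqj i; rewrite eqxx.
  have /andP[] := bnd _ (y1 i); have /andP[] := bnd _ (y1' i).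
  case: (lerP shift ((-1) ^+ b * y i)) => wi;
    case: (lerP shift ((-1) ^+ b * y' i)) => wi' // *.
  (* Both points on the narrow side, where coordinate i varies by 1 - shift. *)
  exfalso; move: far; apply/negP; rewrite -leNgt.
  have bi : (y i - y' i) ^+ 2 <= (1 - shift) ^+ 2.
    by rewrite sqE; apply: sqr_le_of_norm; rewrite ler_norml; lra.
  have b1 j : (y j - y' j) ^+ 2 <= 1.
    have [->|ji] := eqVneq j i; last first.
      by rewrite sqE -[leRHS](expr1n R 2); apply/sqr_le_of_norm/dj.
    by apply: (le_trans bi); nra.
  apply: (le_trans (sum4_le_isolate i b1)); lra.
have bi : `|(-1) ^+ b * y i - (-1) ^+ b * y' i| <= 1 + shift.
  have /andP[] := bnd _ (y1 i); have /andP[] := bnd _ (y1' i).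
  by rewrite ler_norml; lra.
have b1 j : (y j - y' j) ^+ 2 <= (1 + shift) ^+ 2.
  rewrite sqE; apply: sqr_le_of_norm; have [->//|ji] := eqVneq j i.
  by apply: (le_trans (dj j ji)); lra.
have long j : 1 - 9 * shift <= `|(-1) ^+ b * y j - (-1) ^+ b * y' j|.
  rewrite leNgt; apply/negP => /ltW small.
  have := lt_le_trans far (sum4_le_isolate j b1).
  have := sqr_le_of_norm small; rewrite -sqE; lra.
split.
  move=> j; rewrite [`|y j|]normE [`|y' j|]normE.
  have := bnd _ (y1 j); have := bnd _ (y1' j); have := eqj j; have := long j.
  have [->|ji] := eqVneq j i.
    move: wi wi'; move: ((-1) ^+ b * y i) ((-1) ^+ b * y' i) => w w' wi wi' + _.
    move=> + /andP[? ?] /andP[? ?].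
    by case: (ler0P w); case: (ler0P w'); case: (ler0P (w - w')); lra.
  move: ((-1) ^+ b * y j) ((-1) ^+ b * y' j) => w w' + +.
  move=> + + /andP[? ?] /andP[? ?].
  case: (ler0P (w - w')); case: (lerP 0 w); case: (lerP 0 w') => // h1 h2 h3 h4 _;
    rewrite ?(ger0_norm h1) ?(ger0_norm h2) ?(ltr0_norm h1) ?(ltr0_norm h2); lra.
have := bnd _ (y1 i); have := bnd _ (y1' i); have := long i.
move: wi wi'; move: ((-1) ^+ b * y i) ((-1) ^+ b * y' i) => w w' wi wi'.
by move=> + /andP[? ?] /andP[? ?]; case: (ler0P (w - w')); lra.
Qed.

(** [tol] is so small that the square of [2 * (1 - tol)] exceeds [4 - 4^-1]. *)
Lemma antipodal_close (a b a' b' : R) :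
  (a - b) ^+ 2 + (a' - b') ^+ 2 <= 4 ->
  2 * (1 - tol) <= `|a - b| -> `|a' - b'| < 2^-1.
Proof.
move=> h g; rewrite ltNge; apply/negP => k.
have : (2 * (1 - tol)) ^+ 2 <= `|a - b| ^+ 2.
  by rewrite lerXn2r ?nnegrE//; lra.
have : (2^-1) ^+ 2 <= `|a' - b'| ^+ 2 by rewrite lerXn2r ?nnegrE//; lra.
by rewrite !real_normK ?num_real//; lra.
Qed.

(** Halving every side of the cube gives pieces of Euclidean diameter [2]; some
    shifted cut does better by a margin that does not depend on [X]. *)
Lemma euclid_coloring (T : Type) (X : T -> Prop) (y : T -> 'I_4 -> R) :
  (forall x, X x -> forall j, `|y x j| <= 1) ->
  (forall x x', X x -> X x' -> \sum_j (y x j - y x' j) ^+ 2 <= 4) ->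
  exists2 c : R, 0 <= c < 4 &
    exists f : T -> {ffun 'I_4 -> bool}, forall x x', X x -> X x' ->
      f x = f x' -> \sum_j (y x j - y x' j) ^+ 2 <= c.
Proof.
move=> y1 y4; exists short; first by apply/andP; split; lra.
apply: contrapT => noF.
have pairP i (b : bool) : exists u v, [/\ X u, X v,
    corner_pair tol (y u) (y v) & (-1) ^+ b * y u i <= - (1 - tol)].
  apply: contrapT => nop; apply: noF; exists (fun x => shifted_cut shift i b (y x)).
  move=> x x' Xx Xx' eqc; rewrite leNgt; apply/negP => far; apply: nop.
  have [cp [h|h]] := shifted_cut_far (y1 _ Xx) (y1 _ Xx') eqc far.
    by exists x, x'.
  by exists x', x; split => //; apply: corner_pair_sym.
have close u v j k : j != k -> X u -> X v -> 2 * (1 - tol) <= `|y u j - y v j| ->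
    `|y u k - y v k| < 2^-1.
  move=> jk Xu Xv; apply: antipodal_close => //.
  have := y4 _ _ Xu Xv; apply: le_trans.
  rewrite (bigD1 j) //= lerD2l (bigD1 k) 1?eq_sym//=.
  by rewrite lerDl sumr_ge0// => ? _; apply: sqr_ge0.
(* Every extreme value a of coordinate j is opposed by a point of X, and the
   same point opposes the extreme values on the side of a. *)
have opp j a : 1 - tol <= `|a| -> exists u v, [/\ X u, X v,
    corner_pair tol (y u) (y v), 1 - tol <= `|y u j| &
    forall a', 1 - tol <= `|a'| -> `|a - a'| < 2^-1 ->
      2 * (1 - tol) <= `|a' - y u j|].
  move=> ha; have [u [v [Xu Xv uv hu]]] := pairP j (a < 0).
  exists u, v; split => //; move: ha hu; case: (ltrP a 0) => a0;
    rewrite ?(ltr0_norm a0) ?(ger0_norm a0) ?expr1 ?expr0 => ha hu.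
  - by rewrite ler_normr; lra.
  - by rewrite ler_normr; lra.
  - move=> a' h; rewrite ltr_norml => /andP[? ?].
    by move: h; rewrite !ler_normr; lra.
  - move=> a' h; rewrite ltr_norml => /andP[? ?].
    by move: h; rewrite !ler_normr; lra.
(* If u is extreme in i and j, then the point u' opposing u in i agrees with u
   in j; the point w opposing u in j opposes u' as well, so it agrees in i with
   both u and u', although these are opposed there. *)
have low i j u v : i != j -> X u -> X v -> corner_pair tol (y u) (y v) ->
    1 - tol <= `|y u i| -> `|y u j| <= tol.
  move=> ij Xu Xv uv hi; have [[hj _]|[]//] := uv j; exfalso.
  have [u' [v' [Xu' Xv' uv' _ gap_]]] := opp i _ hi.
  have gap : 2 * (1 - tol) <= `|y u i - y u' i|.
    by apply: gap_ => //; rewrite subrr normr0; lra.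
  have cl := close _ _ _ _ ij Xu Xu' gap.
  have hj' : 1 - tol <= `|y u' j|.
    have [[//]|[lj _]] := uv' j.
    have := ler_normD (y u j - y u' j) (y u' j); rewrite subrK.
    by move: hj lj cl; lra.
  have [w [_ [Xw _ _ _ gapw_]]] := opp j _ hj.
  have gapw' := gapw_ _ hj' cl.
  have gapw : 2 * (1 - tol) <= `|y u j - y w j|.
    by apply: gapw_ => //; rewrite subrr normr0; lra.
  have ji : j != i by rewrite eq_sym.
  have c1 := close _ _ _ _ ji Xu Xw gapw.
  have c2 := close _ _ _ _ ji Xu' Xw gapw'.
  have := ler_normB (y u i - y w i) (y u' i - y w i).
  have -> : y u i - y w i - (y u' i - y w i) = y u i - y u' i by ring.
  by move: gap; lra.
(* Now u is extreme in coordinate 0 only, so v is extreme in 1 and 2. *)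
have [u [v [Xu Xv uv hu]]] := pairP ord0 false.
have hu0 : 1 - tol <= `|y u ord0|.
  by move: hu; rewrite expr0 mul1r => ?; rewrite ler_normr; lra.
pose j : 'I_4 := inord 1; pose k : 'I_4 := inord 2.
have [j0 k0 jk] : [/\ ord0 != j, ord0 != k & j != k].
  by split; apply/eqP => /(congr1 val); rewrite /= !inordK.
have lj := low _ _ _ _ j0 Xu Xv uv hu0.
have lk := low _ _ _ _ k0 Xu Xv uv hu0.
have hvj : 1 - tol <= `|y v j| by have [[]|[]//] := uv j; move: lj; lra.
have hvk : 1 - tol <= `|y v k| by have [[]|[]//] := uv k; move: lk; lra.
have := low _ _ _ _ jk Xv Xu (corner_pair_sym uv) hvj; lra.
Qed.

End EuclideanCut.

(** * Recolouring near odd diagonals *)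

Section Recoloring.
Context {R : realFieldType}.

Definition parity n (s : 'I_n -> bool) : bool := \big[addb/false]_i s i.

Lemma parityD n (s t : 'I_n -> bool) :
  parity (fun i => s i (+) t i) = parity s (+) parity t.
Proof. exact: big_split. Qed.

Lemma parity_flip n (b : bool) (i0 : 'I_n) :
  parity (fun i => b && (i0 == i)) = b.
Proof.
rewrite /parity (bigD1 i0) //= eqxx andbT big1 ?addbF// => i ii0.
by rewrite eq_sym (negbTE ii0) andbF.
Qed.

(** The points near a vertex of the grid [{-1, 0, 1}^n] that is not a vertex of
    the big cube. *)
Definition grid_zone n (d : R) (y : 'I_n -> R) : bool :=
  [forall i, (`|y i| <= d) || (1 - d <= `|y i|)] && [exists i, `|y i| <= d].

(** The sign pattern of [y], where one sign is flipped if [y] is in the zone and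
    the signs have the wrong parity.  The flip is made at a coordinate near [0],
    so that the point hardly leaves its new orthant.  The right parity is that
    of the number of coordinates near [1] or [-1]. *)
Definition recolor n (d : R) (y : 'I_n -> R) : {ffun 'I_n -> bool} :=
  let wrong := grid_zone d y && parity (fun i => (y i < 0) (+) (d < `|y i|)) in
  [ffun i => (y i < 0) (+)
             (wrong && ([pick j | `|y j| <= d] == Some i))].

Lemma recolor_parity n (d : R) (y : 'I_n -> R) : grid_zone d y ->
  parity (fun i => recolor d y i (+) (d < `|y i|)) = false.
Proof.
move=> zy; rewrite /recolor zy /=.
case: pickP => [i0 _|none]; last first.
  by case/andP: zy => _ /existsP[i]; rewrite none.
set w := parity (fun i => (y i < 0) (+) _).
apply/eqP; rewrite -(addbb w) -{3}(parity_flip w i0) -parityD; apply/eqP.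
by apply: eq_bigr => i _; rewrite ffunE addbAC.
Qed.

Lemma recolor_offzone n (d : R) (y : 'I_n -> R) i : ~~ grid_zone d y ->
  (-1) ^+ recolor d y i * y i = `|y i|.
Proof. by move=> /negbTE zy; rewrite ffunE zy addbF -normrEsign. Qed.

Lemma recolor_ge n (d : R) (y : 'I_n -> R) i : 0 <= d ->
  - d <= (-1) ^+ recolor d y i * y i.
Proof.
move=> d0; rewrite ffunE; case: andP => [[_ /eqP]|_]; last first.
  by rewrite addbF -normrEsign; apply: le_trans (normr_ge0 _); lra.
case: pickP => // j jd [<-].
by rewrite addbT signrN mulNr -normrEsign lerN2.
Qed.

(** A long difference tells, at each coordinate, which of the two points is near
    [0]; so its signs are those of the colour, reversed where [y] is near [0].
    The parity imposed by [recolor] makes their product [1]. *)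
Lemma zone_pair_even (d : R) (y y' : 'I_4 -> R) : 0 < d -> d <= 10^-1 ->
  (forall i, `|y i| <= 1) -> (forall i, `|y' i| <= 1) ->
  recolor d y = recolor d y' -> grid_zone d y ->
  \sum_i (y i - y' i) ^+ 2 <= 3 * (1 + d) ^+ 2 + (1 - 4 * d) ^+ 2 \/
  exists2 s : 'I_4 -> bool, parity s = false &
    forall i, `|y i - y' i - (-1) ^+ s i| <= 4 * d.
Proof.
move=> d0 d1 y1 y1' eqr zy.
have sgn1 (b : bool) (w : R) : `|w| <= 1 -> `|(-1) ^+ b * w| <= 1.
  by rewrite normrMsign.
have bnd i : - d <= (-1) ^+ recolor d y i * y i <= 1.
  by rewrite (recolor_ge _ _ (ltW d0)) (le_trans (ler_norm _))// sgn1.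
have bnd' i : - d <= (-1) ^+ recolor d y i * y' i <= 1.
  by rewrite {1}eqr (recolor_ge _ _ (ltW d0)) (le_trans (ler_norm _))// sgn1.
have difE i : y i - y' i = (-1) ^+ recolor d y i *
    ((-1) ^+ recolor d y i * y i - (-1) ^+ recolor d y i * y' i).
  by rewrite -mulrBr mulrA -expr2 sqrr_sign mul1r.
have nE i : `|y i - y' i| =
    `|(-1) ^+ recolor d y i * y i - (-1) ^+ recolor d y i * y' i|.
  by rewrite {1}difE normrMsign.
have le1d i : (y i - y' i) ^+ 2 <= (1 + d) ^+ 2.
  apply: sqr_le_of_norm; rewrite nE ler_norml.
  by have /andP[? ?] := bnd i; have /andP[? ?] := bnd' i; lra.
have [/existsP[i short]|] := boolP [exists i, `|y i - y' i| <= 1 - 4 * d].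
  left; rewrite addrC; apply: le_trans (sum4_le_isolate i le1d) _.
  by rewrite lerD2r; apply: sqr_le_of_norm.
rewrite negb_exists => /forallP long; right.
exists (fun i => recolor d y i (+) (d < `|y i|) (+) true).
  by rewrite parityD recolor_parity// /parity !big_ord_recl big_ord0.
move=> i; have := long i; rewrite -ltNge nE difE => long_i.
rewrite !signr_addb expr1 -mulrA -mulrBr normrMsign.
have zi : (`|y i| <= d) || (1 - d <= `|y i|) by case/andP: zy => /forallP.
move: (bnd i) (bnd' i) long_i zi.
have -> : `|y i| = `|(-1) ^+ recolor d y i * y i| by rewrite normrMsign.
move: (_ * y i) (_ * y' i) => w w' /andP[? ?] /andP[? ?]; rewrite ltr_normr.
case: (lerP `|w| d) => [|_ /[swap]] /=.
  by rewrite ler_norml => /andP[? ?] ? _; rewrite ler_norml expr0; lra.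
by rewrite ler_normr => hw ?; rewrite ler_norml expr1; lra.
Qed.

(** Outside the zone no point leaves its orthant, and two such points are never
    almost opposite vertices of a unit cube: one of them would have a coordinate
    near [0] and all of them near [0], [1] or [-1], and so lie in the zone. *)
Lemma recolor_dichotomy (d : R) (y y' : 'I_4 -> R) : 0 < d -> d <= 10^-1 ->
  (forall i, `|y i| <= 1) -> (forall i, `|y' i| <= 1) ->
  recolor d y = recolor d y' ->
  \sum_i (y i - y' i) ^+ 2 <= 3 * (1 + d) ^+ 2 + (1 - 4 * d) ^+ 2 \/
  exists2 s : 'I_4 -> bool, parity s = false &
    forall i, `|y i - y' i - (-1) ^+ s i| <= 4 * d.
Proof.
move=> d0 d1 y1 y1' eqr.
have [zy|zy] := boolP (grid_zone d y); first exact: zone_pair_even.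
have [zy'|zy'] := boolP (grid_zone d y').
  have [le|[s s0 near_s]] := zone_pair_even d0 d1 y1' y1 (esym eqr) zy'.
    left; rewrite (eq_bigr (fun i => (y' i - y i) ^+ 2))// => i _.
    by rewrite -[LHS]sqrrN opprB.
  right; exists (fun i => s i (+) true).
    by rewrite parityD s0 /parity !big_ord_recl big_ord0.
  move=> i; have := near_s i; rewrite -normrN signr_addb expr1.
  by congr (`|_| <= _); ring.
left.
have difE i : `|y i - y' i| = `| `|y i| - `|y' i| |.
  by rewrite -(recolor_offzone i zy) -(recolor_offzone i zy') eqr -mulrBr normrMsign.
have le1 i : (y i - y' i) ^+ 2 <= 1.
  rewrite -[leRHS](expr1n R 2); apply: sqr_le_of_norm; rewrite difE ler_norml.
  have := normr_ge0 (y i); have := normr_ge0 (y' i).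
  by have := y1 i; have := y1' i; lra.
have [/existsP[i short]|] := boolP [exists i, `|y i - y' i| <= 1 - d].
  apply: le_trans (sum4_le_isolate i le1) _.
  by have := sqr_le_of_norm short; nra.
rewrite negb_exists => /forallP long; exfalso.
have split_i i : `|y i| <= d /\ 1 - d <= `|y' i| \/ 1 - d <= `|y i| /\ `|y' i| <= d.
  have := long i; rewrite -ltNge difE ltr_normr.
  have := normr_ge0 (y i); have := normr_ge0 (y' i).
  by have := y1 i; have := y1' i; lra.
have in_zone (z : 'I_4 -> R) : (forall i, `|z i| <= d \/ 1 - d <= `|z i|) ->
    ~~ grid_zone d z -> forall i, d < `|z i|.
  move=> zP; rewrite negb_and => /orP[/negP[]|].
    by apply/forallP => i; apply/orP/zP.
  by rewrite negb_exists => /forallP nz i; rewrite ltNge.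
have hy := in_zone y (fun i => ltac:(case: (split_i i); tauto)) zy ord0.
have hy' := in_zone y' (fun i => ltac:(case: (split_i i); tauto)) zy' ord0.
case: (split_i ord0) => -[h h']; move: h h' hy hy'; lra.
Qed.

End Recoloring.

(** * The Hadamard transform in dimension four *)

Section Hadamard.
Context {R : realFieldType}.

(** Sylvester's matrix: the sign at [(i, j)] is the scalar product modulo 2 of
    the binary expansions of [i] and [j]. *)
Definition hadamard (i j : 'I_4) : R :=
  (-1) ^+ ((odd i && odd j) (+) (odd i./2 && odd j./2)).

Definition hadamard_transform (z : 'I_4 -> R) (i : 'I_4) : R :=
  \sum_k hadamard i k * z k.

Lemma hadamard_inversion (z : 'I_4 -> R) j :
  \sum_i hadamard i j * hadamard_transform z i = 4 * z j.
Proof.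
have [->|[->|[->|->]]] : j = ord0 \/ j = lift ord0 ord0 \/
    j = lift ord0 (lift ord0 ord0) \/ j = lift ord0 (lift ord0 (lift ord0 ord0)).
  by case: j => [[|[|[|[|j]]]] Hj] //;
    [left|right; left|right; right; left|right; right; right]; apply: val_inj.
all: rewrite /hadamard_transform /hadamard !big_ord_recl !big_ord0 /= /bump /=.
all: by rewrite ?expr0 ?expr1; ring.
Qed.

Lemma hadamard_parseval (z : 'I_4 -> R) :
  \sum_i hadamard_transform z i ^+ 2 = 4 * \sum_k z k ^+ 2.
Proof.
rewrite /hadamard_transform /hadamard.
by rewrite !big_ord_recl !big_ord0 /= /bump /= ?expr0 ?expr1; ring.
Qed.

(** The even sign vectors are, up to sign, the columns of the matrix, and the
    columns are orthogonal. *)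
Lemma hadamard_even (s : 'I_4 -> bool) : parity s = false ->
  \sum_j `|\sum_i hadamard i j * (-1) ^+ s i| = 4.
Proof.
rewrite /parity /hadamard !big_ord_recl !big_ord0 /= /bump /= ?expr0 ?expr1.
case: (s _); case: (s _); case: (s _); case: (s _) => //= _.
all: rewrite ?expr0 ?expr1.
all: repeat match goal with |- context [ `|?x| ] =>
  first [ have -> : x = 0 by ring | have -> : x = 4%:R by ring
        | have -> : x = - 4%:R by ring ]; rewrite ?normrN ?normr0 ?normr_nat
  end.
all: by ring.
Qed.

(** The inverse transform of an even sign vector is a unit vector or its
    negative, of [l1]-norm [1], and it does not amplify the error by more
    than [4] in this norm. *)
Lemma l1_near_even_sign (k : R) (z : 'I_4 -> R) (s : 'I_4 -> bool) :
  parity s = false ->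
  (forall i, `|hadamard_transform z i - (-1) ^+ s i| <= k) ->
  \sum_j `|z j| <= 1 + 4 * k.
Proof.
move=> s0 near_s.
have zj j : 4 * `|z j| <= `|\sum_i hadamard i j * (-1) ^+ s i| + 4 * k.
  have -> : 4 * `|z j| = `|\sum_i hadamard i j * (-1) ^+ s i +
      \sum_i hadamard i j * (hadamard_transform z i - (-1) ^+ s i)|.
    rewrite -big_split /=.
    under eq_bigr do rewrite -mulrDr addrC subrK.
    by rewrite hadamard_inversion normrM normr_nat.
  apply: le_trans (ler_normD _ _) _; rewrite lerD2l.
  apply: le_trans (ler_norm_sum _ _ _) _.
  have /le_trans-> // : \sum_i `|hadamard i j *
      (hadamard_transform z i - (-1) ^+ s i)| <= \sum_(i < 4) k.
    by apply: ler_sum => i _; rewrite normrMsign.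
  by rewrite sumr_const card_ord mulr_natl.
have : \sum_j 4 * `|z j| <=
    \sum_j (`|\sum_i hadamard i j * (-1) ^+ s i| + 4 * k).
  by apply: ler_sum.
rewrite -mulr_sumr big_split /= hadamard_even// sumr_const card_ord.
by rewrite -[_ *+ 4]mulr_natl; lra.
Qed.

End Hadamard.

(** * The lp norm and diameters *)

(** The power mean inequality, with [m] an upper bound of the mean; it sums the
    tangent inequality of the concave function [a |-> a `^ q] at [m]. *)
Lemma powR_sum_le (R : realType) n (q m : R) (a : 'I_n -> R) :
  0 < q -> q <= 1 -> 0 < m -> (forall i, 0 <= a i) ->
  \sum_i a i <= n%:R * m -> \sum_i a i `^ q <= n%:R * m `^ q.
Proof.
move=> q0 q1 m0 a0 sum_a; have [->|nq1] := eqVneq q 1.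
  by under eq_bigr do rewrite powRr1//; rewrite powRr1// (ltW m0).
have {nq1}q1 : q < 1 by rewrite lt_neqAle nq1.
have tangent i : a i `^ q * m `^ (1 - q) <= q * a i + (1 - q) * m.
  have := @conjugate_powR R (a i `^ q) (m `^ (1 - q)) q^-1 (1 - q)^-1
    (powR_ge0 _ _) (powR_ge0 _ _).
  rewrite !invr_gt0 q0 subr_gt0 q1 !invrK => /(_ isT isT).
  rewrite -!powRrM !mulfV ?gt_eqF ?subr_gt0// !powRr1 ?a0 ?(ltW m0)//.
  have -> : q + (1 - q) = 1 by ring.
  by rewrite [q * _]mulrC [(1 - q) * _]mulrC; apply.
rewrite -(ler_pM2r (powR_gt0 (1 - q) m0)) -mulrA -powRD; last first.
  by rewrite [m == 0]gt_eqF// implybT.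
have -> : q + (1 - q) = 1 by ring.
rewrite powRr1 ?(ltW m0)// mulr_suml.
apply: (le_trans (ler_sum _ (fun i _ => tangent i))).
rewrite big_split /= -mulr_sumr sumr_const card_ord.
rewrite -[_ *+ n]mulr_natl.
have : q * \sum_i a i <= q * (n%:R * m) by rewrite ler_pM2l.
by lra.
Qed.

Section LpNorm.
Context {R : realType}.

Lemma powR_invl (s r : R) : 0 <= s -> s^-1 `^ r = (s `^ r)^-1.
Proof. by move=> s0; rewrite -powR_inv1// powRAC powR_inv1 ?powR_ge0. Qed.

Lemma lp_norm_ge0 n (p : \bar R) (x : 'rV[R]_n) : 0 <= lp_norm p x.
Proof.
case: p => [r||] //=; first exact: powR_ge0.
by apply: (big_ind (fun v => 0 <= v)) => // a b a0 b0; rewrite le_max a0.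
Qed.

Lemma lp_normK n (r : R) (x : 'rV[R]_n) : 0 < r ->
  lp_norm r%:E x `^ r = \sum_i `|x ord0 i| `^ r.
Proof.
move=> r0 /=; rewrite -powRrM mulVf ?gt_eqF// powRr1//.
by apply: sumr_ge0 => i _; apply: powR_ge0.
Qed.

Lemma coord_le_lp_norm n (p : \bar R) (x : 'rV[R]_n) i : (0 < p)%E ->
  `|x ord0 i| <= lp_norm p x.
Proof.
case: p => [r||] //= r0; last by rewrite (le_bigmax_cond _ (fun i => `|x ord0 i|)).
rewrite lte_fin in r0.
have ri0 : 0 <= r^-1 by rewrite invr_ge0 ltW.
have -> : `|x ord0 i| = (`|x ord0 i| `^ r) `^ r^-1.
  by rewrite -powRrM mulfV ?gt_eqF// powRr1.
apply: ge0_ler_powR; rewrite ?nnegrE ?powR_ge0//.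
  by apply: sumr_ge0 => ? _; apply: powR_ge0.
by rewrite (bigD1 i) //= lerDl sumr_ge0// => ? _; apply: powR_ge0.
Qed.

Lemma lp_norm_scaled_le n (r s B : R) (x : 'rV[R]_n) : 0 < r -> 0 < s ->
  \sum_i `|x ord0 i / s| `^ r <= B -> lp_norm r%:E x <= s * B `^ r^-1.
Proof.
move=> r0 s0 hB /=.
have ri0 : 0 <= r^-1 by rewrite invr_ge0 ltW.
have B0 : 0 <= B by apply: le_trans hB; apply: sumr_ge0 => i _; apply: powR_ge0.
have -> : s * B `^ r^-1 = (s `^ r * B) `^ r^-1.
  by rewrite powRM ?powR_ge0// -powRrM mulfV ?gt_eqF// powRr1 ?(ltW s0).
apply: ge0_ler_powR; rewrite ?nnegrE ?mulr_ge0 ?powR_ge0//.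
  by apply: sumr_ge0 => i _; apply: powR_ge0.
rewrite -ler_pdivrMl ?powR_gt0// mulr_sumr; apply: le_trans hB.
apply: ler_sum => i _.
rewrite normrM normfV (gtr0_norm s0) powRM ?invr_ge0 ?(ltW s0)//.
by rewrite mulrC powR_invl ?(ltW s0).
Qed.

(** This bounds the width of a set of diameter [D] in the direction of any sign
    vector. *)
Lemma l1_le_lp_norm (r D : R) (x : 'rV[R]_4) : 1 <= r -> 0 < D ->
  lp_norm r%:E x <= D -> \sum_i `|x ord0 i| <= 4 * (D / 4 `^ r^-1).
Proof.
move=> r1 D0 xD.
have r0 : 0 < r by lra.
have -> : \sum_i `|x ord0 i| = \sum_i (`|x ord0 i| `^ r) `^ r^-1.
  by apply: eq_bigr => i _; rewrite -powRrM mulfV ?gt_eqF// powRr1.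
have -> : D / 4 `^ r^-1 = (D `^ r / 4) `^ r^-1.
  rewrite powRM ?powR_ge0// -powRrM mulfV ?gt_eqF// powRr1 ?(ltW D0)//.
  by rewrite powR_invl.
apply: powR_sum_le; rewrite ?invr_gt0 ?invf_le1 ?divr_gt0 ?powR_gt0//.
rewrite -lp_normK// mulrC divfK//.
by apply: ge0_ler_powR; rewrite ?nnegrE ?lp_norm_ge0 ?(ltW r0) ?(ltW D0).
Qed.

Lemma bounded_coord n (X : set 'rV[R]_n) : bounded_set X ->
  exists2 M, 0 < M & forall x i, X x -> `|x ord0 i| <= M.
Proof.
move=> [M [_ /(_ (Num.max M 0 + 1))]].
have -> : M < Num.max M 0 + 1 by rewrite ltr_pwDr// le_max lexx.
move=> /(_ isT) XM; exists (Num.max M 0 + 1).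
  by rewrite ltr_wpDl// le_max lexx orbT.
move=> x i /XM /=; apply: le_trans.
rewrite [leRHS]mx_normrE.
by rewrite (le_bigmax_cond _ (fun ij => `|x ij.1 ij.2|) (j := (ord0, i))).
Qed.

Lemma lp_norm_le_diam n (p : \bar R) (X : set 'rV[R]_n) (x y : 'rV[R]_n) :
  (0 < p)%E -> bounded_set X -> X x -> X y -> lp_norm p (x - y) <= lp_diam p X.
Proof.
move=> p0 /bounded_coord[M M0 XM] Xx Xy.
apply: ub_le_sup; last by exists x => //; exists y.
have dM u v i : X u -> X v -> `|(u - v) ord0 i| <= 2 * M.
  move=> Xu Xv; rewrite !mxE; apply: le_trans (ler_normB _ _) _.
  by have := XM u i Xu; have := XM v i Xv; lra.
have M20 : 0 < 2 * M by lra.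
case: p p0 => [r||] //; rewrite ?lte_fin => r0.
  exists (2 * M * n%:R `^ r^-1) => _ [u Xu [v Xv <-]].
  apply: lp_norm_scaled_le => //.
  have -> : n%:R = \sum_(i < n) 1 :> R by rewrite sumr_const card_ord.
  apply: ler_sum => i _.
  rewrite normrM normfV (gtr0_norm M20).
  suff: (`|(u - v) ord0 i| / (2 * M)) `^ r <= 1 `^ r by rewrite powR1.
  apply: ge0_ler_powR; rewrite ?nnegrE ?divr_ge0 ?(ltW r0) ?(ltW M20)//.
  by rewrite ler_pdivrMr// mul1r dM.
exists (2 * M) => _ [u Xu [v Xv <-]] /=.
by apply: bigmax_le => [|i _]; [exact: ltW|exact: dM].
Qed.

Lemma lp_diam_gt0 n (p : \bar R) (X : set 'rV[R]_n) (x y : 'rV[R]_n) :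
  (0 < p)%E -> bounded_set X -> X x -> X y -> x <> y -> 0 < lp_diam p X.
Proof.
move=> p0 bX Xx Xy xy; apply: lt_le_trans (lp_norm_le_diam p0 bX Xx Xy).
have [i xyi] : exists i, (x - y) ord0 i != 0.
  apply: contra_notP xy => /forallNP h; apply/rowP => i.
  by have /negP/negPn/eqP := h i; rewrite !mxE => /subr0_eq.
by apply: lt_le_trans (coord_le_lp_norm _ i p0); rewrite normr_gt0.
Qed.

(** A bound [c] common to all pairs is required: the supremum of distances that
    are each below the diameter may equal it. *)
Lemma diam_reducible_of_coloring n b (C : finType) (p : \bar R)
    (X : set 'rV[R]_n) (f : 'rV[R]_n -> C) (c : R) :
  #|C| = b -> 0 <= c < lp_diam p X ->
  (forall x y, X x -> X y -> f x = f y -> lp_norm p (x - y) <= c) ->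
  diam_reducible p X b.
Proof.
move=> <- /andP[c0 cD] fc.
exists (fun k => [set x | X x /\ enum_rank (f x) = k]); split.
- apply/seteqP; split => [x Xx|x [k _ []//]].
  by exists (enum_rank (f x)).
- by move=> k x [].
move=> k; apply: le_lt_trans cD.
rewrite /lp_diam; set A := (A in sup A).
have [->|/set0P A0] := eqVneq A set0; first by rewrite sup0.
apply: ge_sup => // _ [x [Xx fx] [y [Xy fy] <-]].
by apply: fc => //; apply: enum_rank_inj; rewrite fx fy.
Qed.

(** A function of oscillation at most [2 * s] on [X] takes values in an interval
    of length [2 * s], which is mapped to [[-1, 1]]. *)
Lemma centered_coordinates (T : Type) n (X : set T) (phi : T -> 'I_n -> R) (s : R) :
  0 < s -> (forall x x' i, X x -> X x' -> `|phi x i - phi x' i| <= 2 * s) ->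
  exists y : T -> 'I_n -> R, (forall x, X x -> forall i, `|y x i| <= 1) /\
    forall x x' i, y x i - y x' i = (phi x i - phi x' i) / s.
Proof.
move=> s0 width.
exists (fun x i => (phi x i - (sup [set phi u i | u in X] - s)) / s); split.
  move=> x Xx i; rewrite normrM normfV (gtr0_norm s0) ler_pdivrMr// mul1r.
  have le_sup : phi x i <= sup [set phi u i | u in X].
    apply: ub_le_sup; last by exists x.
    exists (phi x i + 2 * s) => _ [u Xu <-].
    by have := width u x i Xu Xx; rewrite ler_norml; lra.
  have : sup [set phi u i | u in X] <= phi x i + 2 * s.
    apply: ge_sup; first by exists (phi x i); exists x.
    by move=> _ [u Xu <-]; have := width u x i Xu Xx; rewrite ler_norml; lra.
  by rewrite ler_norml; lra.
by move=> x x' i; rewrite -mulrBl; congr (_ / s); ring.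
Qed.

End LpNorm.

(** * The partition for each exponent *)

Section Partition.
Context {R : realType}.
Implicit Types (X : set 'rV[R]_4) (p : \bar R) (r : R).

Lemma gt1_ltr_powR (a x y : R) : 1 < a -> x < y -> a `^ x < a `^ y.
Proof.
move=> a1 xy; have a0 : a != 0 by rewrite gt_eqF//; lra.
by rewrite /powR (negbTE a0) ltr_expR ltr_pM2r// ln_gt0.
Qed.

Lemma ltr_scaled_powR (r s B G : R) : 0 < r -> 0 < s -> 0 <= B -> B < G ->
  s * B `^ r^-1 < s * G `^ r^-1.
Proof.
move=> r0 s0 B0 BG; rewrite ltr_pM2l//.
by apply: gt0_ltr_powR; rewrite ?invr_gt0 ?nnegrE// (le_trans B0)// ltW.
Qed.

Lemma powR_le1 (a r : R) : 0 <= r -> 0 <= a -> a <= 1 -> a `^ r <= 1.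
Proof.
move=> r0 a0 a1; suff: a `^ r <= 1 `^ r by rewrite powR1.
by apply: ge0_ler_powR; rewrite ?nnegrE.
Qed.

Lemma diam_coordinates p X : (0 < p)%E -> bounded_set X ->
  0 < lp_diam p X ->
  exists y : 'rV[R]_4 -> 'I_4 -> R, (forall x, X x -> forall i, `|y x i| <= 1) /\
    forall x x' i, y x i - y x' i = (x - x') ord0 i / (lp_diam p X / 2).
Proof.
move=> p0 bX D0; have D20 : 0 < lp_diam p X / 2 by lra.
have [|y [y1 yB]] := @centered_coordinates R _ _ X (fun x i => x ord0 i) _ D20.
  move=> x x' i Xx Xx'; have := coord_le_lp_norm (x - x') i p0.
  by have := lp_norm_le_diam p0 bX Xx Xx'; rewrite !mxE; lra.
by exists y; split => // x x' i; rewrite yB !mxE.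
Qed.

Lemma diam_reducible_oo X : bounded_set X -> 0 < lp_diam +oo%E X ->
  diam_reducible +oo%E X (2 ^ 4).
Proof.
move=> bX D0; have [//|y [y1 yB]] := diam_coordinates _ bX D0.
apply: (diam_reducible_of_coloring (C := {ffun 'I_4 -> bool})
  (f := fun x => [ffun i => 0 <= y x i]) (c := lp_diam +oo%E X / 2)).
- by rewrite card_ffun card_bool card_ord.
- by lra.
move=> x x' Xx Xx' /ffunP eqf /=; apply: bigmax_le => [|i _]; first by lra.
have := eqf i; rewrite !ffunE => eqi.
have := same_side_dist (y1 _ Xx i) (y1 _ Xx' i) eqi.
rewrite yB normrM normfV; set D2 := lp_diam _ _ / 2.
have D20 : 0 < D2 by rewrite /D2; lra.
by rewrite (gtr0_norm D20) ler_pdivrMr// mul1r.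
Qed.

Lemma diam_reducible_gt2 r X : 2 < r -> bounded_set X ->
  0 < lp_diam r%:E X -> diam_reducible r%:E X (2 ^ 4).
Proof.
move=> r2 bX D0; have r0 : 0 < r by lra.
have [|y [y1 yB]] := diam_coordinates _ bX D0; first by rewrite lte_fin.
set D2 := lp_diam _ _ / 2 in yB; have D20 : 0 < D2 by rewrite /D2; lra.
apply: (diam_reducible_of_coloring (C := {ffun 'I_4 -> bool})
  (f := fun x => [ffun i => 0 <= y x i]) (c := D2 * 4 `^ r^-1)).
- by rewrite card_ffun card_bool card_ord.
- rewrite mulr_ge0 ?powR_ge0 ?(ltW D20)//=.
  have -> : lp_diam r%:E X = D2 * (2 `^ r) `^ r^-1.
    by rewrite -powRrM mulfV ?gt_eqF// powRr1// /D2 divfK.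
  apply: ltr_scaled_powR => //.
  have -> : 4 = 2 `^ 2%:R :> R by rewrite powR_mulrn//; ring.
  by apply: gt1_ltr_powR => //; rewrite ltr1n.
move=> x x' Xx Xx' /ffunP eqf; apply: lp_norm_scaled_le => //.
have -> : (4 : R) = \sum_(i < 4) 1 by rewrite sumr_const card_ord.
apply: ler_sum => i _; rewrite -yB; apply: powR_le1; rewrite ?(ltW r0)//.
by apply: same_side_dist; rewrite ?y1//; have := eqf i; rewrite !ffunE.
Qed.

Lemma powR2 (a : R) : `|a| `^ 2%:R = a ^+ 2.
Proof. by rewrite powR_mulrn// real_normK ?num_real. Qed.

Lemma diam_reducible_eq2 X : bounded_set X ->
  0 < lp_diam 2%:R%:E X -> diam_reducible 2%:R%:E X (2 ^ 4).
Proof.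
move=> bX D0; have [|y [y1 yB]] := diam_coordinates _ bX D0.
  by rewrite lte_fin ltr0n.
set D2 := lp_diam _ _ / 2 in yB; have D20 : 0 < D2 by rewrite /D2; lra.
have sq2 : (4 : R) `^ 2%:R^-1 = 2.
  by rewrite (_ : 4 = 2 `^ 2%:R) -?powRrM ?mulfV ?powRr1// powR_mulrn//; ring.
have [|c /andP[c0 c4] [f f_dist]] := euclid_coloring y1.
  move=> x x' Xx Xx'; under eq_bigr do rewrite yB -powR2 normrM powRM//.
  rewrite -mulr_suml powR2 -lp_normK ?ltr0n//.
  have -> : (4 : R) = (lp_diam 2%:R%:E X) `^ 2%:R * D2^-1 ^+ 2.
    by rewrite powR_mulrn ?(ltW D0)// /D2; field; rewrite gt_eqF.
  rewrite ler_pM2r ?exprn_gt0 ?invr_gt0//.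
  apply: ge0_ler_powR; rewrite ?nnegrE ?lp_norm_ge0 ?(ltW D0)//.
  by apply: lp_norm_le_diam => //; rewrite lte_fin ltr0n.
apply: (diam_reducible_of_coloring (f := f)
  (c := D2 * c `^ 2%:R^-1)).
- by rewrite card_ffun card_bool card_ord.
- rewrite mulr_ge0 ?powR_ge0 ?(ltW D20)//=.
  have -> : lp_diam 2%:R%:E X = D2 * 4 `^ 2%:R^-1 by rewrite sq2 /D2; lra.
  by apply: ltr_scaled_powR; rewrite ?ltr0n.
move=> x x' Xx Xx' eqf; apply: lp_norm_scaled_le; rewrite ?ltr0n//.
apply: le_trans (f_dist x x' Xx Xx' eqf).
by under eq_bigr do rewrite -yB powR2.
Qed.

(** Applied to vectors near a unit vector, with [M] near [1]. *)
Lemma sum_powR_le_l1 r (M : R) (w : 'I_4 -> R) : 1 <= r -> r <= 2 -> 1 <= M ->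
  \sum_i `|w i| <= M -> \sum_i `|w i| `^ r <= M ^+ 2.
Proof.
move=> r1 r2 M1 wM.
have wi i : `|w i| <= M.
  by apply: le_trans wM; rewrite (bigD1 i) //= lerDl sumr_ge0.
apply: (@le_trans _ _ (\sum_i `|w i| * M)); last first.
  by rewrite -mulr_suml expr2 ler_pM2r//; lra.
apply: ler_sum => i _; rewrite -mulr_powRB1 ?ler_wpM2l//; last by lra.
apply: (@le_trans _ _ (M `^ (r - 1))).
  by apply: ge0_ler_powR; rewrite ?nnegrE//; lra.
by apply: ler1_powR => //; lra.
Qed.

Lemma sum_powR_le_l2 r (m : R) (w : 'I_4 -> R) : 0 < r -> r <= 2 -> 0 < m ->
  \sum_i w i ^+ 2 <= 4 * m -> \sum_i `|w i| `^ r <= 4 * m `^ (r / 2).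
Proof.
move=> r0 r2 m0 wm.
have -> : \sum_i `|w i| `^ r = \sum_i (w i ^+ 2) `^ (r / 2).
  by apply: eq_bigr => i _; rewrite -powR2 -powRrM mulrC divfK.
by apply: powR_sum_le => //; try lra; move=> i; apply: sqr_ge0.
Qed.

Lemma hadamard_transformB_scale (x x' : 'rV[R]_4) (s : R) i :
  (hadamard_transform (x ord0) i - hadamard_transform (x' ord0) i) / s =
  hadamard_transform (fun k => (x - x') ord0 k / s) i.
Proof.
rewrite /hadamard_transform -sumrB mulr_suml.
by apply: eq_bigr => k _; rewrite !mxE -mulrBr mulrA.
Qed.

Lemma diam_reducible_lt2 r X : 1 <= r -> r < 2 -> bounded_set X ->
  0 < lp_diam r%:E X -> diam_reducible r%:E X (2 ^ 4).
Proof.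
move=> r1 r2 bX D0; have r0 : 0 < r by lra.
have pr0 : (0 < r%:E)%E by rewrite lte_fin.
set D := lp_diam _ _ in D0 *.
(* s is half the side of the box, and s * G `^ r^-1 the lp-norm of the
   difference of opposite vertices along an odd diagonal of an orthant. *)
pose s := 2 * (D / 4 `^ r^-1).
have s0 : 0 < s by rewrite mulr_gt0// divr_gt0// powR_gt0.
pose G : R := 4 * 2^-1 `^ r.
have sG : s * G `^ r^-1 = D.
  rewrite powRM ?powR_ge0// -powRrM mulfV ?gt_eqF// powRr1// /s.
  by field; rewrite gt_eqF// powR_gt0.
have G1 : 1 < G.
  rewrite /G powR_invl// ltr_pdivlMr ?powR_gt0// mul1r.
  have -> : 4 = 2 `^ 2%:R :> R by rewrite powR_mulrn//; ring.
  by apply: gt1_ltr_powR => //; rewrite ltr1n.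
have [|y [y1 yB]] := @centered_coordinates R _ _ X
    (fun x => hadamard_transform (x ord0)) _ s0.
  move=> x x' i Xx Xx'.
  have := l1_le_lp_norm r1 D0 (lp_norm_le_diam pr0 bX Xx Xx').
  have -> : 2 * s = 4 * (D / 4 `^ r^-1) by rewrite /s; ring.
  apply: le_trans; rewrite /hadamard_transform -sumrB.
  apply: le_trans (ler_norm_sum _ _ _) _; apply: ler_sum => k _.
  by rewrite -mulrBr normrMsign !mxE.
(* d is so small that the short and the even differences, of norms at most
   s * m' `^ r^-1 for the two members m' of the maximum B, stay below D. *)
pose d : R := Num.min 10^-1 ((G - 1) / 100).
have [d0 d1 dG] : [/\ 0 < d, d <= 10^-1 & 100 * d <= G - 1].
  rewrite /d; case: (leP 10^-1 ((G - 1) / 100)) => ?; split; lra.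
pose m : R := (3 * (1 + d) ^+ 2 + (1 - 4 * d) ^+ 2) / 16.
have [m0 m4] : 0 < m /\ m < 4^-1 by rewrite /m; split; nra.
pose B := Num.max (4 * m `^ (r / 2)) ((1 + 16 * d) ^+ 2).
have BG : B < G.
  rewrite gt_max; apply/andP; split; last by nra.
  rewrite /G ltr_pM2l//.
  have -> : 2^-1 `^ r = 4^-1 `^ (r / 2) :> R.
    rewrite (_ : 4^-1 = 2^-1 `^ 2%:R) -?powRrM ?[2%:R * _]mulrC ?divfK//.
    by rewrite powR_mulrn//; field.
  by apply: gt0_ltr_powR; rewrite ?nnegrE ?divr_gt0//; lra.
have B0 : 0 <= B by rewrite le_max mulr_ge0 ?powR_ge0.
apply: (diam_reducible_of_coloring (f := fun x => recolor d (y x))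
  (c := s * B `^ r^-1)).
- by rewrite card_ffun card_bool card_ord.
- rewrite mulr_ge0 ?powR_ge0 ?(ltW s0)//= -/D -sG.
  exact: ltr_scaled_powR.
move=> x x' Xx Xx' eqf; apply: lp_norm_scaled_le => //.
set w := fun k : 'I_4 => (x - x') ord0 k / s.
have yw i : y x i - y x' i = hadamard_transform w i.
  by rewrite yB hadamard_transformB_scale.
rewrite le_max; have [near|[t t0 near]] :=
  recolor_dichotomy d0 d1 (y1 _ Xx) (y1 _ Xx') eqf.
- apply/orP; left; apply: (@sum_powR_le_l2 r m w) => //; first exact: ltW.
  move: near; under eq_bigr do rewrite yw.
  by rewrite hadamard_parseval /m; lra.
- apply/orP; right; apply: (@sum_powR_le_l1 r _ w) => //; try lra.
  rewrite (_ : 16 * d = 4 * (4 * d)); last by ring.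
  apply: l1_near_even_sign t0 _ => i; rewrite -yw; exact: near.
Qed.

End Partition.

Theorem theorem1p1 (R : realType) (p : \bar R) (hp : (1 <= p)%E)
    (X : set 'rV[R]_4) (hbounded : bounded_set X)
    (htwo : exists x y : 'rV[R]_4, [/\ X x, X y & x <> y]) :
  exists b : nat, is_borsuk_number p X b /\ (b <= 2 ^ 4)%N.
Proof.
have red : diam_reducible p X (2 ^ 4).
  have p0 : (0 < p)%E by apply: lt_le_trans hp; rewrite lte_fin.
  have [x [y [Xx Xy xy]]] := htwo.
  have := lp_diam_gt0 p0 hbounded Xx Xy xy.
  case: p hp {p0} => [r||] // hr D0; last exact: diam_reducible_oo.
  rewrite lee_fin in hr.
  have [r2|r2|r2] := ltgtP r 2.
  - exact: diam_reducible_lt2.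
  - exact: diam_reducible_gt2.
  - by rewrite r2 in D0 *; apply: diam_reducible_eq2.
(* The Borsuk number itself is the least admissible count. *)
have ex : exists b, `[< diam_reducible p X b >] by exists (2 ^ 4)%N; apply/asboolP.
have [b /asboolP bred bmin] := ex_minnP ex.
exists b; split; last by apply: bmin; apply/asboolP.
by split => // c cred; apply: bmin; apply/asboolP.
Qed.
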